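(* Let $m,n\ge 1$ be integers and let $P_{\mathbf A}(z)=I z^m+A_{m-1}z^{m-1}+\cdots+A_1z+A_0$ and $P_{\bar{\mathbf A}}(z)=I z^m+\bar A_{m-1}z^{m-1}+\cdots+\bar A_1z+\bar A_0$ be monic matrix polynomials with $A_i,\bar A_i\in\mathbb C^{n\times n}$ whose companion matrices $C_{\mathbf A}$ and $C_{\bar{\mathbf A}}$ are both normal. Then $$\mathrm{dist}_F(\sigma(\mathbf A),\sigma(\bar{\mathbf A}))\le |\mathbf A-\bar{\mathbf A}|_F .$$
   Context: $I$ is the $n\times n$ identity matrix. $\mathbf A=(A_0,\dots,A_{m-1},I)$ and $\bar{\mathbf A}=(\bar A_0,\dots,\bar A_{m-1},I)$ are the coefficient tuples. The companion matrix of $P_{\mathbf A}$ is the $mn\times mn$ block matrix $$C_{\mathbf A}=\begin{bmatrix}0&I&0&\cdots&0\\0&0&I&\cdots&0\\ \vdots&\vdots&\vdots&&\vdots\\0&0&0&\cdots&I\\-A_0&-A_1&-A_2&\cdots&-A_{m-1}\end{bmatrix}$$ (for $m=1$, $C_{\mathbf A}=-A_0$). $\sigma(\mathbf A)$ is the spectrum of $P_{\mathbf A}$: the $mn$ roots $\alpha_1,\dots,\alpha_{mn}$ of $\det P_{\mathbf A}(z)$, listed with multiplicity; similarly $\sigma(\bar{\mathbf A})=\{\bar\alpha_1,\dots,\bar\alpha_{mn}\}$. The Frobenius distance is $$\mathrm{dist}_F(\sigma(\mathbf A),\sigma(\bar{\mathbf A}))=\min_\theta\Big(\sum_{j=1}^{mn}|\alpha_j-\bar\alpha_{\theta(j)}|^2\Big)^{1/2},$$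 the minimum being over all permutations $\theta$ of $\{1,\dots,mn\}$. The Frobenius norm of a matrix is the square root of the sum of the squared moduli of its entries, and $|\mathbf A-\bar{\mathbf A}|_F=\big(\sum_{i=0}^{m-1}|A_i-\bar A_i|_F^2\big)^{1/2}$. *)

(* Defs.v *)
From mathcomp Require Import all_boot all_order all_fingroup all_algebra.
From mathcomp Require Import reals complex.

Set Implicit Arguments.
Unset Strict Implicit.
Unset Printing Implicit Defensive.

Import Order.TTheory GRing.Theory Num.Theory.

Local Open Scope ring_scope.
Local Open Scope complex_scope.

(* A tuple (A_0, ..., A_{m-1}, I) is represented by A : 'I_m -> 'M_n; its last
   entry, the leading coefficient I, is left implicit. *)

Definition mxpolynomial (R : realType) (m n : nat) (A : 'I_m -> 'M[R[i]]_n) :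
    'M[{poly R[i]}]_n :=
  'X^m%:M + \sum_(i < m) 'X^i *: map_mx polyC (A i).

(* For m = 1 the only block is in the last block row, so this is - A_0. *)
Definition companion (R : realType) (m n : nat) (A : 'I_m -> 'M[R[i]]_n) :
    'M[R[i]]_(\sum_(i < m) n) :=
  \mxblock_(i < m, j < m)
    (if i.+1 == m :> nat then - A j
     else if j == i.+1 :> nat then 1%:M else 0).

(* alpha lists the roots of det P_A with multiplicity, in an arbitrary order;
   det P_A is monic of degree m * n, see is_spectrum_exists. *)
Definition is_spectrum (R : realType) (m n : nat) (A : 'I_m -> 'M[R[i]]_n)
    (alpha : 'I_(m * n) -> R[i]) : Prop :=
  \det (mxpolynomial A) = \prod_(j < m * n) ('X - (alpha j)%:P).

Definition match_cost (R : realType) (N : nat) (a b : 'I_N -> R[i])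
    (theta : 'S_N) : R :=
  Num.sqrt (\sum_(j < N) Normc.normc (a j - b (theta j)) ^+ 2).

(* The initial value of the iterated minimum is the cost of the identity
   permutation, one of the values over which the minimum is taken. *)
Definition distF (R : realType) (N : nat) (a b : 'I_N -> R[i]) : R :=
  \big[Num.min/match_cost a b 1%g]_(theta : 'S_N) match_cost a b theta.

Definition frobenius (R : realType) (p q : nat) (M : 'M[R[i]]_(p, q)) : R :=
  Num.sqrt (\sum_(i < p) \sum_(j < q) Normc.normc (M i j) ^+ 2).

Definition tuple_distF (R : realType) (m n : nat) (A B : 'I_m -> 'M[R[i]]_n) :
    R :=
  Num.sqrt (\sum_(i < m) frobenius (A i - B i) ^+ 2).

Lemma mxpolynomialE (R : realType) (m n : nat) (A : 'I_m -> 'M[R[i]]_n) i j :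
  mxpolynomial A i j = 'X^m *+ (i == j) + \poly_(k < m) (if insub k is Some l
    then A l i j else 0).
Proof.
rewrite !mxE summxE poly_def; congr (_ + _).
by apply: eq_bigr => k _; rewrite !mxE valK -mul_polyC mulrC.
Qed.

Lemma det_mxpolynomial_monic (R : realType) (m n : nat)
    (A : 'I_m -> 'M[R[i]]_n) :
  \det (mxpolynomial A) \is monic /\ size (\det (mxpolynomial A)) = (m * n).+1.
Proof.
set P := mxpolynomial A.
have Pdiag k : P k k \is monic /\ size (P k k) = m.+1.
  rewrite /P mxpolynomialE eqxx mulr1n.
  set q := \poly_(_ < _) _; have sq : (size q < size ('X^m : {poly R[i]}))%N.
    by rewrite size_polyXn ltnS size_poly.
  by rewrite monicE lead_coefDl // lead_coefXn size_polyDl // size_polyXn.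
have Poff k l : k != l -> (size (P k l) <= m)%N.
  by move=> /negPf kl; rewrite /P mxpolynomialE kl mulr0n add0r size_poly.
have Pany k l : (size (P k l) <= m.+1)%N.
  have [<-|/Poff /leqW //] := eqVneq k l; by case: (Pdiag k) => _ ->.
have mon1 : \prod_(k < n) P k k \is monic.
  by apply: monic_prod => k _; case: (Pdiag k).
have sz1 : size (\prod_(k < n) P k k) = (m * n).+1.
  rewrite size_prod; last by move=> k _; rewrite monic_neq0 //; case: (Pdiag k).
  rewrite (eq_bigr (fun _ => m.+1)); last by move=> k _; case: (Pdiag k).
  by rewrite sum_nat_const card_ord mulnS -addnS addKn mulnC.
rewrite /determinant (bigD1 1%g) //= odd_perm1 expr0 mul1r.
under eq_bigr do rewrite perm1.
set q := \sum_(_ | _) _.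
have sq : (size q < size (\prod_(k < n) P k k)%R)%N.
  rewrite sz1 ltnS; apply: (leq_trans (size_sum _ _ _)).
  apply/bigmax_leqP => s s1.
  rewrite -signr_odd size_Msign.
  have [k ks] : exists k, k != s k.
    apply/existsP; apply: contraNT s1 => /existsPn H.
    by apply/eqP/permP => k; move: (H k); rewrite negbK perm1 => /eqP <-.
  apply: (leq_trans (size_poly_prod_leq _ _)).
  rewrite leq_subLR card_ord; rewrite (bigD1 k) //=.
  have n_gt0 : (0 < n)%N by apply: leq_trans (ltn_ord k).
  have le2 : (\sum_(l < n | l != k) size (P l (s l)) <= n.-1 * m.+1)%N.
    apply: (@leq_trans (\sum_(l < n | l != k) m.+1)).
      by apply: leq_sum => l _; apply: Pany.
    by rewrite sum_nat_const cardC1 card_ord.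
  apply: (@leq_ltn_trans (m + n.-1 * m.+1)).
    by apply: leq_add => //; apply: Poff.
  rewrite -[in ltnRHS](prednK n_gt0) !mulnS.
  by rewrite addSn ltnS [(m * _)%N]mulnC addnCA.
by rewrite monicE lead_coefDl // size_polyDl // sz1; split=> //; rewrite -monicE.
Qed.

Lemma is_spectrum_exists (R : realType) (m n : nat) (A : 'I_m -> 'M[R[i]]_n) :
  exists alpha, is_spectrum A alpha.
Proof.
have [mon sz] := det_mxpolynomial_monic A.
have [r] := closed_field_poly_normal (\det (mxpolynomial A)).
rewrite (monicP mon) scale1r => def.
have sr : size r = (m * n)%N.
  by apply: succn_inj; rewrite -sz def size_prod_XsubC.
exists (fun j => r`_j); rewrite /is_spectrum def (big_nth 0) sr.
by rewrite big_mkord.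
Qed.

(* Main.v *)
(* The Hoffman-Wielandt inequality for the two companion matrices: all their
   block rows but the last coincide, so the squared Frobenius norm of their
   difference is the sum of the |A_i - Abar_i|_F^2.  For Hoffman-Wielandt, if
   A = U^* D U and B = V^* E V with U, V unitary, then
   |A - B|_F^2 = |D W - W E|_F^2 = sum_ij |d_i - e_j|^2 |W_ij|^2 for W = U V^*,
   and (|W_ij|^2) is doubly stochastic, so this linear cost is at least its
   value at some permutation matrix. *)
Require Import Defs.
From mathcomp Require Import all_boot all_order all_fingroup all_algebra.
From mathcomp Require Import reals complex.

Set Implicit Arguments.
Unset Strict Implicit.
Unset Printing Implicit Defensive.

Import Order.TTheory GRing.Theory Num.Theory.

Local Open Scope ring_scope.
Local Open Scope sesquilinear_scope.

Local Notation normc := Normc.normc.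

(** * Doubly stochastic matrices and permutations *)

(** Supplies a direction in which a doubly stochastic matrix can be moved, both ways, without
    changing its row and column sums or creating new nonzero entries. *)
Lemma zero_sum_mx_in_support (K : fieldType) n (S : 'M[K]_n.+1) :
  (forall i, 2 <= #|[set j | S i j != 0%R]|)%N ->
  exists X : 'M[K]_n.+1, [/\ X != 0, forall i j, S i j = 0 -> X i j = 0,
    forall i, \sum_j X i j = 0 & forall j, \sum_i X i j = 0].
Proof.
move=> S2; pose E := [set p : 'I_n.+1 * 'I_n.+1 | S p.1 p.2 != 0].
have cardE : (n.+1 + n < #|E|)%N.
  have -> : #|E| = (\sum_i #|[set j | S i j != 0%R]|)%N.
    rewrite -sum1dep_card; under [RHS]eq_bigr do rewrite -sum1dep_card.
    by rewrite pair_big_dep.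
  rewrite -addnS addnn -muln2 -[X in (X * 2)%N]card_ord -sum_nat_const.
  exact: leq_sum.
(* At least 2 n + 2 unknowns for 2 n + 1 equations: the one for column 0 follows
   from the others. *)
pose M := row_mx (\matrix_(e < #|E|, i < n.+1) ((enum_val e).1 == i)%:R)
                 (\matrix_(e < #|E|, j < n) ((enum_val e).2 == lift ord0 j)%:R)
   : 'M[K]_(_, _).
have /rowV0Pn[v /sub_kermxP vM v0] : kermx M != 0.
  rewrite -mxrank_eq0 mxrank_ker subn_eq0 -ltnNge.
  by rewrite (leq_ltn_trans _ cardE)// rank_leq_col.
move: vM; rewrite /M mul_mx_row => /eqP; rewrite row_mx_eq0.
move=> /andP[/eqP vr /eqP vc].
(* Extension of [v] by zero outside the support: as [enum_val] is injective, each sum has at most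
   one term. *)
pose X := \matrix_(i, j) \sum_(e | enum_val e == (i, j)) v 0 e.
have rowX i : \sum_j X i j = 0.
  move/matrixP/(_ 0 i): vr; rewrite !mxE => H; rewrite -[RHS]H.
  rewrite (eq_bigr (fun j => \sum_e if enum_val e == (i, j) then v 0 e else 0)).
    rewrite exchange_big; apply: eq_bigr => e _ /=; rewrite mxE.
    rewrite (bigD1 (enum_val e).2)//= big1 ?addr0 => [|j /negPf jE].
      case: (enum_val e) => a b /=.
      by rewrite xpair_eqE eqxx andbT mulr_natr -mulrb.
    case: (enum_val e) jE => a b /=.
    by rewrite xpair_eqE eq_sym => ->; rewrite andbF.
  by move=> j _; rewrite mxE big_mkcond.
have colXl j : \sum_i X i (lift ord0 j) = 0.
  move/matrixP/(_ 0 j): vc; rewrite !mxE => H; rewrite -[RHS]H.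
  rewrite (eq_bigr (fun i =>
    \sum_e if enum_val e == (i, lift ord0 j) then v 0 e else 0)).
    rewrite exchange_big; apply: eq_bigr => e _ /=; rewrite mxE.
    rewrite (bigD1 (enum_val e).1)//= big1 ?addr0 => [|i /negPf iE].
      case: (enum_val e) => a b /=.
      by rewrite xpair_eqE eqxx /= mulr_natr -mulrb.
    by case: (enum_val e) iE => a b /=; rewrite xpair_eqE eq_sym => ->.
  by move=> i _; rewrite mxE big_mkcond.
exists X; split=> //.
- apply: contra_neq v0 => X0; apply/rowP => e; rewrite mxE.
  move/matrixP/(_ (enum_val e).1 (enum_val e).2): X0.
  rewrite !mxE -surjective_pairing.
  by rewrite (big_pred1 e)// => f; rewrite (inj_eq enum_val_inj).
- move=> i j Sij; rewrite mxE big1// => e /eqP eij.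
  by have := enum_valP e; rewrite eij inE /= Sij eqxx.
- move=> j; case: (unliftP ord0 j) => [k ->|->]; first exact: colXl.
  have : \sum_j \sum_i X i j = 0 by rewrite exchange_big big1.
  by rewrite big_ord_recl [X in _ + X]big1 ?addr0.
Qed.

(** Moving from [S] along [X], in the direction that does not raise the cost, until the first entry
    reaches zero. *)
Lemma shift_support (K : realFieldType) n (c S X : 'M[K]_n) :
  (forall i j, 0 <= S i j) -> X != 0 -> (forall i j, S i j = 0 -> X i j = 0) ->
  (forall i, \sum_j X i j = 0) ->
  (forall j, \sum_i X i j = 0) ->
  exists S' : 'M[K]_n,
  [/\ forall i j, 0 <= S' i j, forall i, \sum_j S' i j = \sum_j S i j,
     forall j, \sum_i S' i j = \sum_i S i j,
     [set p | S' p.1 p.2 != 0] \proper [set p | S p.1 p.2 != 0]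
   & \sum_i \sum_j c i j * S' i j <= \sum_i \sum_j c i j * S i j].
Proof.
(* The cost is linear, so one of [X] and [- X] does not raise it, and both satisfy the
   hypotheses. *)
move=> S0; wlog cX : X / \sum_i \sum_j c i j * X i j <= 0.
  move=> H X0 XS Xr Xc.
  have [/H|/ltW cX] := leP (\sum_i \sum_j c i j * X i j) 0; first exact.
  apply: (H (- X)).
  - rewrite -oppr_ge0 -sumrN; under eq_bigr do rewrite -sumrN.
    by under eq_bigr do under eq_bigr do rewrite mxE mulrN opprK.
  - by rewrite oppr_eq0.
  - by move=> i j /XS; rewrite mxE => ->; rewrite oppr0.
  - by move=> i; under eq_bigr do rewrite mxE; rewrite sumrN Xr oppr0.
  - by move=> i; under eq_bigr do rewrite mxE; rewrite sumrN Xc oppr0.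
move=> X0 XS Xr Xc.
(* Otherwise every row of [X] would be nonnegative with sum zero, forcing [X = 0]. *)
have [p0 p0X] : exists p : 'I_n * 'I_n, X p.1 p.2 < 0.
  apply/existsP; apply: contraNT X0 => /existsPn X0; apply/eqP/matrixP => i j.
  rewrite mxE; apply: (psumr_eq0P _ (Xr i)) => // k _.
  by have := X0 (i, k); rewrite -leNgt.
(* Ratio test: the minimal ratio is the largest step that keeps all entries nonnegative, and it
   makes the entry at [p] vanish. *)
pose p := [arg min_(p < p0 | X p.1 p.2 < 0) (S p.1 p.2 / - X p.1 p.2)]%O.
have [pX pmin] : X p.1 p.2 < 0 /\ forall q, X q.1 q.2 < 0 ->
    S p.1 p.2 / - X p.1 p.2 <= S q.1 q.2 / - X q.1 q.2.
  by rewrite /p; case: arg_minP.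
pose t := S p.1 p.2 / - X p.1 p.2.
have t0 : 0 <= t by rewrite divr_ge0// oppr_ge0 ltW.
exists (S + t *: X); split.
- move=> i j; rewrite !mxE; have [Xij|Xij] := ltP (X i j) 0.
    have := pmin (i, j) Xij; rewrite /= ler_pdivlMr ?oppr_gt0// mulrN.
    by rewrite -subr_ge0 opprK.
  by rewrite addr_ge0// mulr_ge0.
- move=> i; under eq_bigr do rewrite !mxE.
  by rewrite big_split /= -mulr_sumr Xr mulr0 addr0.
- move=> i; under eq_bigr do rewrite !mxE.
  by rewrite big_split /= -mulr_sumr Xc mulr0 addr0.
- apply/properP; split.
    apply/subsetP => -[i j]; rewrite !inE /= !mxE; apply: contra_neq => Sij.
    by rewrite Sij XS// mulr0 addr0.
  exists p; rewrite inE.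
    by apply: contra_ltN pX => /eqP/XS ->.
  rewrite negbK !mxE /t invrN mulrN mulNr mulfVK ?subrr//.
  by rewrite lt_eqF.
- under eq_bigr => i _.
    under eq_bigr do rewrite !mxE mulrDr mulrCA.
    rewrite big_split /= -mulr_sumr.
    over.
  by rewrite big_split /= -mulr_sumr gerDl mulr_ge0_le0.
Qed.

(* Induction on the size of the support: while every row has two nonzero
   entries, a zero-sum perturbation shrinks the support without raising the
   cost; otherwise some row is a unit vector, and it is removed together with
   the column of its 1. *)
Lemma birkhoff_cost (K : realFieldType) n (c S : 'M[K]_n) :
  (forall i j, 0 <= S i j) -> (forall i, \sum_j S i j = 1) ->
  (forall j, \sum_i S i j = 1) ->
  exists s : 'S_n, \sum_i c i (s i) <= \sum_i \sum_j c i j * S i j.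
Proof.
elim: n c S => [|n IHn] c S.
  by move=> _ _ _; exists 1%g; rewrite !big_ord0.
have [k] := ubnP #|[set p | S p.1 p.2 != 0]|.
elim: k S => // k IHk S /ltnSE Sk S0 Sr Sc.
have [/forallP S2|] := boolP [forall i, 2 <= #|[set j | S i j != 0%R]|]%N.
  have [X [X0 XS Xr Xc]] := zero_sum_mx_in_support S2.
  have [S' [S'0 S'r S'c S'S S'cost]] := shift_support c S0 X0 XS Xr Xc.
  have [||||s sP] := IHk S'.
  - exact: leq_trans (proper_card S'S) Sk.
  - by [].
  - by move=> i; rewrite S'r.
  - by move=> j; rewrite S'c.
  by exists s; apply: le_trans sP S'cost.
move=> /forallPn[i0]; rewrite -ltnNge ltnS => Si0.
have [j0 Sij0] : exists j, S i0 j != 0.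
  apply/existsP; apply: contraT => /existsPn H.
  have := Sr i0; rewrite big1 => [/esym/eqP|j _]; first by rewrite oner_eq0.
  by apply/eqP; move: (H j); rewrite negbK.
have Sr0 j : j != j0 -> S i0 j = 0.
  move=> jj0; apply/eqP/negPn/negP => Sij.
  have /card_le1_eqP /(_ j j0) := Si0; rewrite !inE => /(_ Sij Sij0) jE.
  by rewrite jE eqxx in jj0.
have S1 : S i0 j0 = 1.
  by rewrite -(Sr i0) (bigD1 j0)//= big1 ?addr0.
(* The entry 1 exhausts the sum of column [j0], whose other entries are nonnegative. *)
have Sc0 i : i != i0 -> S i j0 = 0.
  move=> ii0; have := Sc j0; rewrite (bigD1 i0)//= S1 => /eqP.
  rewrite -[X in _ == X]addr0 (inj_eq (addrI _)) => /eqP H.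
  exact: (psumr_eq0P _ H).
pose S' := \matrix_(i, j) S (lift i0 i) (lift j0 j).
have [|||s sP] := IHn (\matrix_(i, j) c (lift i0 i) (lift j0 j)) S'.
- by move=> i j; rewrite mxE.
- move=> i; rewrite -(Sr (lift i0 i)) (bigD1_ord j0)//= Sc0 ?add0r.
    by apply: eq_bigr => j _; rewrite mxE.
  by rewrite eq_sym neq_lift.
- move=> j; rewrite -(Sc (lift j0 j)) (bigD1_ord i0)//= Sr0 ?add0r.
    by apply: eq_bigr => i _; rewrite mxE.
  by rewrite eq_sym neq_lift.
(* Sends [i0] to [j0] and follows [s] on the remaining indices. *)
exists (lift_perm i0 j0 s).
rewrite (bigD1_ord i0)//= lift_perm_id [leRHS](bigD1_ord i0)//=.
rewrite (bigD1 j0)//= S1 mulr1.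
rewrite [X in _ <= _ + X + _]big1 ?addr0 => [|j /Sr0 ->]; last by rewrite mulr0.
rewrite lerD2l; apply: (le_trans (le_trans _ sP)).
  by apply: ler_sum => i _; rewrite mxE lift_perm_lift.
apply: ler_sum => i _; rewrite [leRHS](bigD1_ord j0)//= Sc0 ?mulr0 ?add0r.
  by apply: ler_sum => j _; rewrite !mxE.
by rewrite eq_sym neq_lift.
Qed.

(** * Characteristic polynomials and unitary diagonalization *)

Lemma char_poly_conj (F : fieldType) n (P D : 'M[F]_n) :
  P \in unitmx -> char_poly (invmx P *m D *m P) = char_poly D.
Proof.
move=> uP; rewrite /char_poly /char_poly_mx.
have VP : map_mx polyC (invmx P) *m map_mx polyC P = 1%:M.
  by rewrite -map_mxM mulVmx// map_mx1.
have -> : 'X%:M - map_mx polyC (invmx P *m D *m P) =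
    map_mx polyC (invmx P) *m ('X%:M - map_mx polyC D) *m map_mx polyC P.
  by rewrite !map_mxM mulmxBr mulmxBl scalar_mxC -(mulmxA _%:M) VP mulmx1.
by rewrite !det_mulmx mulrAC -det_mulmx VP det1 mul1r.
Qed.

(** Unique factorization. It matches eigenvalues listed in an arbitrary order with the diagonal
    given by the spectral theorem. *)
Lemma prod_XsubC_perm (F : fieldType) n (f g : 'I_n -> F) :
  \prod_i ('X - (f i)%:P) = \prod_i ('X - (g i)%:P) ->
  exists s : 'S_n, f =1 g \o s.
Proof.
move=> fg; have /tuple_permP[s fs] :
    perm_eq [tuple f i | i < n] [tuple g i | i < n].
  by apply: prod_XsubC_eq; rewrite !big_map -!enumT !big_enum.
exists s => i.
have /val_inj/(congr1 (@tnth _ _ ^~ i)) := fs.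
by rewrite !tnth_mktuple.
Qed.

Lemma char_poly_unitary_diag (C : numClosedFieldType) n
    (P : 'M[C]_n) (d : 'rV_n) :
  P \is unitarymx ->
  char_poly (invmx P *m diag_mx d *m P) = \prod_i ('X - (d 0 i)%:P).
Proof.
move=> /unitarymx_unit uP; rewrite char_poly_conj// char_poly_trig//.
by apply: eq_bigr => i _; rewrite mxE eqxx.
Qed.

Lemma unitary_diag_sub (C : numClosedFieldType) n
    (U V : 'M[C]_n) (d e : 'rV_n) i j :
  U \is unitarymx -> V \is unitarymx ->
  (U *m (invmx U *m diag_mx d *m U - invmx V *m diag_mx e *m V) *m V^t*) i j =
  (d 0 i - e 0 j) * (U *m V^t*) i j.
Proof.
move=> uU uV; rewrite mulmxBr mulmxBl !invmx_unitary// !mulmxA.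
rewrite (unitarymxP uU) mul1mx mulmxtVK// -(mulmxA _ U).
move: (U *m _) => W; rewrite mul_diag_mx mul_mx_diag !mxE.
by rewrite [W i j * _]mulrC -mulrBl.
Qed.

(** * Frobenius norms, unitary matrices and the Hoffman-Wielandt inequality *)

Lemma normc_sqrE (R : rcfType) (z : R[i]) : ((normc z ^+ 2)%:C)%C = z * z^*.
Proof. by rewrite -normCK rmorphXn. Qed.

Lemma normc_sqrM (R : rcfType) (z w : R[i]) :
  normc (z * w) ^+ 2 = normc z ^+ 2 * normc w ^+ 2.
Proof. by rewrite Normc.normcM exprMn. Qed.

Lemma sum_normc_trace (R : rcfType) m n (M : 'M[R[i]]_(m, n)) :
  ((\sum_i \sum_j normc (M i j) ^+ 2)%:C)%C = \tr (M *m M^t*).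
Proof.
rewrite raddf_sum; apply: eq_bigr => i _; rewrite raddf_sum mxE.
by apply: eq_bigr => j _; rewrite /= normc_sqrE !mxE.
Qed.

(** Written as a trace, the left side loses [V] by unitarity, then [U] by cyclicity of the trace and
    unitarity. *)
Lemma sum_normc_unitary (R : rcfType) m n
    (U : 'M[R[i]]_m) (V : 'M[R[i]]_n) (M : 'M_(m, n)) :
  U \is unitarymx -> V \is unitarymx ->
  \sum_i \sum_j normc ((U *m M *m V^t*) i j) ^+ 2 =
  \sum_i \sum_j normc (M i j) ^+ 2.
Proof.
move=> uU uV; apply: (@complexI R); rewrite !sum_normc_trace.
have -> : (U *m M *m V^t*)^t* = V *m M^t* *m U^t*.
  by rewrite !trmx_mul !map_mxM trmxCK mulmxA.
rewrite !mulmxA mulmxKtV//.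
by rewrite mxtrace_mulC !mulmxA -[U^t*]mul1mx mulmxKtV// mul1mx.
Qed.

Lemma unitary_doubly_stochastic (R : rcfType) n (W : 'M[R[i]]_n) :
  W \is unitarymx ->
  (forall i, \sum_j normc (W i j) ^+ 2 = 1) /\
  (forall j, \sum_i normc (W i j) ^+ 2 = 1).
Proof.
have row1 (V : 'M[R[i]]_n) i : V \is unitarymx -> \sum_j normc (V i j) ^+ 2 = 1.
  move=> /unitarymxP/matrixP/(_ i i); rewrite !mxE eqxx => H.
  apply: (@complexI R); rewrite raddf_sum -[RHS]H.
  by apply: eq_bigr => j _; rewrite /= normc_sqrE !mxE.
move=> uW; split=> [i|j]; first exact: row1.
(* Columns of [W] are rows of its transpose, which is unitary too. *)
by rewrite -(row1 W^T j) ?trmx_unitary//; apply: eq_bigr => i _; rewrite mxE.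
Qed.

Theorem hoffman_wielandt (R : rcfType) n (A B : 'M[R[i]]_n)
    (a b : 'I_n -> R[i]) :
  A \is normalmx -> B \is normalmx ->
  char_poly A = \prod_i ('X - (a i)%:P) ->
  char_poly B = \prod_i ('X - (b i)%:P) ->
  exists s : 'S_n, \sum_i normc (a i - b (s i)) ^+ 2 <=
                   \sum_i \sum_j normc ((A - B) i j) ^+ 2.
Proof.
move=> /orthomx_spectralP.
move: (spectralmx A) (spectral_diag A) (spectral_unitarymx A) => U d uU defA.
move=> /orthomx_spectralP.
move: (spectralmx B) (spectral_diag B) (spectral_unitarymx B) => V e uV defB.
have -> : char_poly A = \prod_i ('X - (d 0 i)%:P).
  by rewrite defA char_poly_unitary_diag.
move=> /esym/prod_XsubC_perm[sa sa_].
have -> : char_poly B = \prod_i ('X - (e 0 i)%:P).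
  by rewrite defB char_poly_unitary_diag.
move=> /esym/prod_XsubC_perm[sb sb_].
pose W := U *m V^t*.
have uW : W \is unitarymx by rewrite mul_unitarymx ?trmxC_unitary.
have [Wr Wc] := unitary_doubly_stochastic uW.
have [|||s sP] := @birkhoff_cost R n (\matrix_(i, j) normc (d 0 i - e 0 j) ^+ 2)
    (\matrix_(i, j) normc (W i j) ^+ 2).
- by move=> i j; rewrite mxE sqr_ge0.
- by move=> i; rewrite -[RHS](Wr i); apply: eq_bigr => j _; rewrite mxE.
- by move=> j; rewrite -[RHS](Wc j); apply: eq_bigr => i _; rewrite mxE.
(* Here [a i = d (sa i)] and [b i = e (sb i)], and products of permutations apply the left factor
   first: [a i] is paired with [e (s (sa i))], and reindexing by [sa] gives the cost of [s]. *)
exists (sa * s * sb^-1)%g; apply: (le_trans (le_trans _ sP)).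
  rewrite [leRHS](reindex_inj (@perm_inj _ sa)) ler_sum// => i _.
  by rewrite mxE sa_ sb_ /= !permM permKV.
rewrite -(sum_normc_unitary (A - B) uU uV).
rewrite ler_sum// => i _; rewrite ler_sum// => j _.
by rewrite defA defB unitary_diag_sub// normc_sqrM !mxE.
Qed.

(** * Block determinants and the characteristic polynomial of the companion matrix *)

Lemma det_castmx (T : comNzRingType) (p q : nat) (e e' : p = q) (M : 'M[T]_p) :
  \det (castmx (e, e') M) = \det M.
Proof. by case: _ / e e' => e'; rewrite (eq_irrelevance e' erefl) castmx_id. Qed.

(** Induction on the number of blocks: without its first block the first block row is zero, so the
    determinant splits. The dimensions are sums, equal only up to a cast. *)
Lemma det_mxblock_lower (T : comNzRingType) (p : nat) (p_ : 'I_p -> nat)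
    (B : forall i j, 'M[T]_(p_ i, p_ j)) :
  (forall i j : 'I_p, (i < j)%N -> B i j = 0) ->
  \det (\mxblock_(i, j) B i j) = \prod_i \det (B i i).
Proof.
elim: p p_ B => [|p IHp] p_ B B0.
  rewrite -(det_castmx (big_ord0 _ _ _ _) (big_ord0 _ _ _ _)) det_mx00.
  by rewrite big_ord0.
rewrite mxblock_recul det_castmx.
have -> : \mxrow_j B ord0 (lift ord0 j) = 0.
  by rewrite -[RHS]mxrow0; apply: eq_mxrow => j; rewrite B0.
by rewrite det_lblock IHp ?big_ord_recl// => i j ij; rewrite B0.
Qed.

Lemma det_mxblock_upper (T : comNzRingType) (p : nat) (p_ : 'I_p -> nat)
    (B : forall i j, 'M[T]_(p_ i, p_ j)) :
  (forall i j : 'I_p, (j < i)%N -> B i j = 0) ->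
  \det (\mxblock_(i, j) B i j) = \prod_i \det (B i i).
Proof.
move=> B0; rewrite -det_tr tr_mxblock det_mxblock_lower => [|i j ij].
  by under eq_bigr do rewrite det_tr.
by rewrite B0// trmx0.
Qed.

Lemma scalar_mxblock (T : pzSemiRingType) (m n : nat) (a : T) :
  a%:M = \mxblock_(i < m, j < m) ((a *+ (i == j))%:M : 'M_n).
Proof.
rewrite -mxdiagZ; apply: eq_mxblock => i j; case: eqP => _.
  by rewrite conform_mx_id.
by rewrite mulr0n raddf0.
Qed.

Lemma char_poly_mxblock (T : nzRingType) (m n : nat)
    (B : 'I_m -> 'I_m -> 'M[T]_n) :
  char_poly_mx (\mxblock_(i, j) B i j) =
  \mxblock_(i, j) (('X *+ (i == j))%:M - map_mx polyC (B i j) : 'M_n).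
Proof.
rewrite /char_poly_mx scalar_mxblock.
have -> : map_mx polyC (\mxblock_(i, j) B i j) =
          \mxblock_(i, j) (map_mx polyC (B i j) : 'M_n).
  by apply/matrixP => i j; rewrite !mxE.
by rewrite mxblockB.
Qed.

Lemma char_poly_companion (R : realType) (m n : nat) (hm : (1 <= m)%N)
    (A : 'I_m -> 'M[R[i]]_n) :
  char_poly (companion A) = \det (mxpolynomial A).
Proof.
(* The first m block columns of Z *m F are those of Z = X I - C, while the last
   one is (0, ..., 0, P_A); so Z *m F = D *m L with D block upper triangular and
   L block lower triangular, and det F = det D. *)
case: m hm A => // m _ A; rewrite /char_poly /companion char_poly_mxblock.
set Z := mxblock _.
(* The identity with last block column [I, X I, ..., X^m I]; [m] is now the number of blocks minus
   one. *)
pose F := \mxblock_(i < m.+1, j < m.+1)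
  ((if j == ord_max then 'X^i else (i == j)%:R)%:M : 'M[{poly R[i]}]_n).
(* [D] keeps the upper left m by m blocks of [Z] and adds an identity block in the corner; [L] is
   the identity except for its last block row, [A_0, ..., A_{m-1}, P_A]. *)
pose D := \mxblock_(i < m.+1, j < m.+1)
  ((if j == ord_max then (i == j)%:R
   else 'X *+ (i == j) - (j == i.+1 :> nat)%:R)%:M : 'M[{poly R[i]}]_n).
pose L := \mxblock_(i < m.+1, j < m.+1)
  (if i == ord_max then
     if j == ord_max then mxpolynomial A else map_mx polyC (A j)
   else (i == j)%:R%:M : 'M[{poly R[i]}]_n).
have ZF : Z *m F = D *m L.
  have sumr (G : 'I_m.+1 -> 'M[{poly R[i]}]_n) j :
      \sum_k G k *m ((k == j)%:R%:M : 'M_n) = G j.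
    rewrite (bigD1 j)//= eqxx mulmx1 big1 ?addr0// => k /negPf->.
    by rewrite raddf0 mulmx0.
  have suml (G : 'I_m.+1 -> 'M[{poly R[i]}]_n) j :
      \sum_k ((j == k)%:R%:M : 'M_n) *m G k = G j.
    rewrite (bigD1 j)//= eqxx mul1mx big1 ?addr0// => k.
    rewrite eq_sym => /negPf->.
    by rewrite raddf0 mul0mx.
  have ltm (k : 'I_m.+1) : k != ord_max -> (k < m)%N.
    by rewrite -val_eqE /= ltn_neqAle -ltnS ltn_ord andbT.
  rewrite !mul_mxblock; apply: eq_mxblock => i j; rewrite eqSS.
  have [->|im] := eqVneq i ord_max.
    rewrite (eqxx m).
    under [RHS]eq_bigr => k _.
      have -> : (if k == ord_max then (ord_max == k)%:R
          else 'X *+ (ord_max == k) - (k == m.+1 :> nat)%:R)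
          = (ord_max == k)%:R :> {poly R[i]}.
        case: eqVneq => // km; rewrite mulr0n.
        by rewrite (ltn_eqF (ltn_ord k)) subr0.
      over.
    rewrite suml eqxx; case: eqVneq => [jm|jm]; last first.
      by rewrite sumr eq_sym (negPf jm) mulr0n raddf0 sub0r map_mxN opprK.
    rewrite /mxpolynomial.
    (* Corner block: [X * X^m] from the diagonal plus all terms [A_k X^k]. *)
    under eq_bigr do rewrite map_mxN opprK mulmxDl -!scalar_mxM mul_mx_scalar.
    rewrite big_split /= (bigD1 ord_max)//= big1 => [|k /negPf kj]; last first.
      by rewrite eq_sym kj mulr0n mul0r raddf0.
    by rewrite eqxx addr0 -exprS.
  rewrite (ltn_eqF (ltm _ im)).
  (* Off the last row, the last column of [D] is zero, so the last block row of [L] may be replaced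
     by that of the identity. *)
  under [RHS]eq_bigr => k _.
    have -> : ((if k == ord_max then (i == k)%:R
        else 'X *+ (i == k) - (k == i.+1 :> nat)%:R)%:M : 'M[{poly R[i]}]_n) *m
      (if k == ord_max
       then if j == ord_max then mxpolynomial A else map_mx polyC (A j)
       else (k == j)%:R%:M) =
       (if k == ord_max then 0
        else ('X *+ (i == k) - (k == i.+1 :> nat)%:R)%:M) *m (k == j)%:R%:M.
      by case: eqVneq => [->|//]; rewrite (negPf im) raddf0 !mul0mx.
    over.
  rewrite sumr.
  have Zik k : ('X *+ (i == k))%:M
        - map_mx polyC (if k == i.+1 :> nat then 1%:M else 0 : 'M[R[i]]_n)
      = ('X *+ (i == k) - (k == i.+1 :> nat)%:R)%:M.
    rewrite raddfB; congr (_ - _).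
    by case: eqP => _; rewrite ?map_scalar_mx ?polyC1// map_mx0 raddf0.
  under eq_bigr do rewrite Zik.
  (* In the last column only k = i and k = i + 1 contribute: [X * X^i - X^(i+1) = 0]. *)
  case: eqVneq => jm; last by rewrite sumr.
  under eq_bigr do rewrite -scalar_mxM.
  rewrite -raddf_sum -[RHS](raddf0 (@scalar_mx {poly R[i]} n)); congr (_%:M).
  under eq_bigr do rewrite mulrBl.
  rewrite sumrB (bigD1 i)//= big1 => [|k /negPf ki]; last first.
    by rewrite eq_sym ki mulr0n mul0r.
  have iS : (i.+1 < m.+1)%N by rewrite ltnS ltm.
  rewrite (bigD1 (Ordinal iS))//= big1 => [|k /negPf ki]; last first.
    by rewrite -val_eqE in ki; rewrite ki mul0r.
  by rewrite !eqxx mul1r !addr0 mulr1n exprS subrr.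
have detF : \det F = 'X^m ^+ n.
  rewrite /F det_mxblock_upper => [|i j ji].
    rewrite big_ord_recr /= eqxx det_scalar big1 ?mul1r// => k _.
    by rewrite -val_eqE /= ltn_eqF// eqxx det_scalar expr1n.
  have /negPf -> : j != ord_max.
    by rewrite -val_eqE /= ltn_eqF// (leq_trans ji)// -ltnS.
  by rewrite -val_eqE /= gtn_eqF// raddf0.
have detD : \det D = 'X^m ^+ n.
  rewrite /D det_mxblock_upper => [|i j ji].
    rewrite big_ord_recr /= !eqxx det1 mulr1.
    under eq_bigr => k _.
      rewrite det_scalar -val_eqE /= ltn_eqF// eqxx ltn_eqF// subr0.
      over.
    by rewrite prodr_const card_ord mulr1n -exprM mulnC exprM.
  have /negPf -> : j != ord_max.
    by rewrite -val_eqE /= ltn_eqF// (leq_trans ji)// -ltnS.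
  by rewrite -val_eqE /= gtn_eqF// mulr0n ltn_eqF ?subr0 ?raddf0// ltnS ltnW.
have detL : \det L = \det (mxpolynomial A).
  rewrite /L det_mxblock_lower => [|i j ij].
    rewrite big_ord_recr /= !eqxx big1 ?mul1r// => k _.
    by rewrite -val_eqE /= ltn_eqF// eqxx det_scalar expr1n.
  have /negPf -> : i != ord_max.
    by rewrite -val_eqE /= ltn_eqF// (leq_trans ij)// -ltnS.
  by rewrite -val_eqE /= ltn_eqF// raddf0.
have := congr1 determinant ZF; rewrite !det_mulmx detF detD detL.
rewrite mulrC; apply: mulfI.
by rewrite -exprM expf_neq0// polyX_eq0.
Qed.

(** * Frobenius distance of companion matrices and the conclusion *)

Lemma sum_mxblock (T : Type) (V : nmodType) (p q : nat)
    (p_ : 'I_p -> nat) (q_ : 'I_q -> nat)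
    (B : forall i j, 'M[T]_(p_ i, q_ j)) (f : T -> V) :
  \sum_s \sum_t f ((\mxblock_(i, j) B i j) s t) =
  \sum_i \sum_j \sum_k \sum_l f (B i j k l).
Proof.
(* The order i, k, j, l puts each block number next to the position inside the block; [tagnat.sig]
   then encodes each such pair as one index. *)
under [RHS]eq_bigr do rewrite exchange_big.
rewrite [RHS]sig_big_dep [RHS](reindex _ tagnat.sig_bij_on)/=.
apply: eq_bigr => s _; rewrite sig_big_dep [RHS](reindex _ tagnat.sig_bij_on)/=.
by apply: eq_bigr => t _; rewrite mxE.
Qed.

Lemma frobenius_sqr (R : realType) p q (M : 'M[R[i]]_(p, q)) :
  frobenius M ^+ 2 = \sum_i \sum_j normc (M i j) ^+ 2.
Proof.
rewrite sqr_sqrtr// sumr_ge0// => i _; rewrite sumr_ge0// => j _.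
exact: sqr_ge0.
Qed.

Lemma frobenius_companion_sub (R : realType) (m n : nat) (hm : (1 <= m)%N)
    (A B : 'I_m -> 'M[R[i]]_n) :
  \sum_i \sum_j normc ((companion A - companion B) i j) ^+ 2 =
  \sum_k frobenius (A k - B k) ^+ 2.
Proof.
have n0 : normc (0 : R[i]) ^+ 2 = 0 by rewrite Normc.normc0 expr0n.
case: m hm A B => // m _ A B; rewrite /companion -mxblockB.
rewrite (sum_mxblock _ (fun z => normc z ^+ 2)) (bigD1 ord_max)//=.
rewrite [X in _ + X]big1 => [|i im]; last first.
  have /ltn_eqF iS : (i.+1 < m.+1)%N.
    by move: im; rewrite -val_eqE /= ltnS ltn_neqAle -ltnS ltn_ord andbT.
  rewrite iS; do 3!(rewrite big1// => ? _).
  by rewrite subrr mxE.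
rewrite addr0; apply: eq_bigr => k _; rewrite frobenius_sqr eqxx.
apply: eq_bigr => i _; apply: eq_bigr => j _.
by rewrite -opprD mxE normcN.
Qed.

Local Open Scope complex_scope.

Theorem proposition2p2 (R : realType) (m n : nat) (hm : (1 <= m)%N)
    (hn : (1 <= n)%N) (A Abar : 'I_m -> 'M[R[i]]_n)
    (hA : companion A \is normalmx) (hAbar : companion Abar \is normalmx)
    (alpha alphabar : 'I_(m * n) -> R[i])
    (halpha : is_spectrum A alpha) (halphabar : is_spectrum Abar alphabar) :
  distF alpha alphabar <= tuple_distF A Abar.
Proof.
(* The companion size [\sum_(i < m) n] equals [m * n] only propositionally; a variable size [N]
   allows the substitution. *)
have HW N (e : N = (m * n)%N) (M M' : 'M[R[i]]_N) :
    M \is normalmx -> M' \is normalmx ->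
    char_poly M = \prod_j ('X - (alpha j)%:P) ->
    char_poly M' = \prod_j ('X - (alphabar j)%:P) ->
    exists s : 'S_(m * n), \sum_j normc (alpha j - alphabar (s j)) ^+ 2 <=
      \sum_i \sum_j normc ((M - M') i j) ^+ 2.
  by subst N; exact: hoffman_wielandt.
have [|||s sP] := HW _ _ _ _ hA hAbar.
- by rewrite sum_nat_const card_ord.
- by rewrite char_poly_companion.
- by rewrite char_poly_companion.
apply: (@bigmin_inf _ _ _ _ s) => //.
by rewrite ler_wsqrtr// -frobenius_companion_sub.
Qed.
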